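(* If a PTR-submanifold $M$ of a Sasakian manifold has maximal totally real distribution $\mathcal D^{\perp}$, then $\mathcal D^{\perp}$ is integrable.
   Context: A Sasakian manifold $(\overline M^{2m+1},\phi,\xi,\eta,g)$ consists of a Riemannian metric $g$ with Levi-Civita connection $\widetilde\nabla$, a $(1,1)$-tensor field $\phi$, a vector field $\xi$ (the Reeb field) and a 1-form $\eta$ with $\phi^2X=-X+\eta(X)\xi$, $\eta(\xi)=1$, $\phi\xi=0$, $g(\phi X,\phi Y)=g(X,Y)-\eta(X)\eta(Y)$ and $(\widetilde\nabla_X\phi)Y=g(X,Y)\xi-\eta(Y)X$; in particular $\widetilde\nabla_X\xi=-\phi X$. Let $M$ be an immersed submanifold with $\xi\in\Gamma(TM)$. For $X\in TM$ write $\phi X=PX+FX$ with $PX$ tangent and $FX$ normal. A PTR (partially totally real) submanifold is such an $M$ with a chosen nonzero constant-rank distribution $\mathcal D^{\perp}\subset TM\cap\ker\eta$ satisfying $\phi\mathcal D^{\perp}\subset T^{\perp}M$. It has maximal totally real distribution if $\mathcal D^{\perp}=\ker(P|_{TM\cap\ker\eta})$. *)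

(* Defs.v *)
From HB Require Import structures.
From mathcomp Require Import all_boot all_order all_algebra.
From mathcomp Require Import all_classical all_reals all_analysis.
Import numFieldNormedType.Exports.
Import Order.TTheory GRing.Theory Num.Theory.
Set Implicit Arguments.
Unset Strict Implicit.
Unset Printing Implicit Defensive.
Local Open Scope classical_set_scope.
Local Open Scope ring_scope.

Fixpoint Ck (R : realType) (E F : normedModType R) (k : nat) (U : set E)
    (f : E -> F) : Prop :=
  if k is k'.+1 then
    (forall x, U x -> differentiable f x) /\
    (forall v : E, Ck k' U (fun x => 'd f x v))
  else forall x, U x -> {for x, continuous f}.

(* Only used for U open. *)
Definition smooth_on (R : realType) (E F : normedModType R) (U : set E)
    (f : E -> F) : Prop := forall k, Ck k U f.

(* The map and its inverse are total functions; their values outside the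
   domain, resp. its image, are irrelevant. *)
Record chart (R : realType) (n : nat) (T : topologicalType) := Chart {
  chart_map :> T -> 'rV[R]_n;
  chart_inv : 'rV[R]_n -> T;
  chart_dom : set T;
  chart_dom_open : open chart_dom;
  chart_img_open : open (chart_map @` chart_dom);
  chart_mapK : forall p, chart_dom p -> chart_inv (chart_map p) = p;
  chart_map_continuous :
    forall p, chart_dom p -> {for p, continuous chart_map};
  chart_inv_continuous :
    forall x, (chart_map @` chart_dom) x -> {for x, continuous chart_inv} }.

(* The atlas need not be maximal.  [chart_at p] is a preferred chart around
   [p]; it is only used to represent the tangent space at [p], see below. *)
Record manifold (R : realType) (n : nat) := Manifold {
  mfd_space :> topologicalType;
  mfd_hausdorff : hausdorff_space mfd_space;
  mfd_second_countable : @second_countable mfd_space;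
  atlas : set (chart R n mfd_space);
  atlas_compatible : forall c d, atlas c -> atlas d ->
    smooth_on (c @` (chart_dom c `&` chart_dom d)) (d \o chart_inv c);
  chart_at : mfd_space -> chart R n mfd_space;
  chart_at_atlas : forall p, atlas (chart_at p);
  chart_at_dom : forall p, chart_dom (chart_at p) p }.

(* Scalar functions that are smooth on the open set U of M. *)
Definition smooth_fun (R : realType) (n : nat) (M : manifold R n) (U : set M)
    (f : M -> R^o) : Prop :=
  forall c, atlas c -> smooth_on (c @` (chart_dom c `&` U)) (f \o chart_inv c).

Definition smooth_map (R : realType) (n m : nat) (N : manifold R n)
    (M : manifold R m) (i : N -> M) : Prop :=
  continuous i /\
  forall c d, atlas c -> atlas d ->
    smooth_on (c @` (chart_dom c `&` i @^-1` chart_dom d))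
              (d \o i \o chart_inv c).

(* A tangent vector at p is given by its components in the chart [chart_at p];
   [tangent_coord c v] are its components in another chart c around p. *)
Definition tangent (R : realType) (n : nat) (M : manifold R n) (p : M) : Type :=
  'rV[R]_n.

HB.instance Definition _ (R : realType) (n : nat) (M : manifold R n) (p : M) :=
  Vector.copy (tangent p) 'rV[R]_n.

Definition tangent_coord (R : realType) (n : nat) (M : manifold R n)
    (c : chart R n M) (p : M) (v : tangent p) : 'rV[R]_n :=
  'd (c \o chart_inv (chart_at p)) (chart_at p p) v.

(* The derivative v(f) of f along v. *)
Definition vderiv (R : realType) (n : nat) (M : manifold R n) (p : M)
    (v : tangent p) (f : M -> R^o) : R :=
  'd (f \o chart_inv (chart_at p)) (chart_at p p) v.

Definition mdiff (R : realType) (n m : nat) (N : manifold R n)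
    (M : manifold R m) (i : N -> M) (p : N) (v : tangent p) : tangent (i p) :=
  'd (chart_at (i p) \o i \o chart_inv (chart_at p)) (chart_at p p) v.

Definition immersion (R : realType) (n m : nat) (N : manifold R n)
    (M : manifold R m) (i : N -> M) : Prop :=
  smooth_map i /\ forall p : N, injective (@mdiff R n m N M i p).

Definition vfield (R : realType) (n : nat) (M : manifold R n) :=
  forall p : M, tangent p.

Definition vfield_coord (R : realType) (n : nat) (M : manifold R n)
    (c : chart R n M) (X : vfield M) : 'rV[R]_n -> 'rV[R]_n :=
  fun x => tangent_coord c (X (chart_inv c x)).

(* X restricts to a smooth vector field on the open set U. *)
Definition smooth_vfield (R : realType) (n : nat) (M : manifold R n)
    (U : set M) (X : vfield M) : Prop :=
  forall c, atlas c ->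
    smooth_on (c @` (chart_dom c `&` U)) (vfield_coord c X).

(* [X, Y] = X^j d_j Y - Y^j d_j X, computed in the chart at p. *)
Definition lie_bracket (R : realType) (n : nat) (M : manifold R n)
    (X Y : vfield M) : vfield M := fun p =>
  let c := chart_at p in
  'd (vfield_coord c Y) (c p) (vfield_coord c X (c p)) -
  'd (vfield_coord c X) (c p) (vfield_coord c Y (c p)).

Record riemannian_metric (R : realType) (n : nat) (M : manifold R n)
    (g : forall p : M, tangent p -> tangent p -> R) : Prop := RiemannianMetric {
  metric_linear : forall p a (u v w : tangent p),
    g p (a *: u + v) w = a * g p u w + g p v w;
  metric_sym : forall p (u v : tangent p), g p u v = g p v u;
  metric_pos : forall p (u : tangent p), u != 0 -> 0 < g p u u;
  metric_smooth : forall (U : set M) (X Y : vfield M), open U ->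
    smooth_vfield U X -> smooth_vfield U Y ->
    smooth_fun U (fun p => g p (X p) (Y p)) }.

(* [nabla v Y] is the covariant derivative at p of Y in the direction v; it is
   only constrained when Y is smooth on a neighbourhood of p, i.e. nabla acts
   on local smooth vector fields. *)
Record affine_connection (R : realType) (n : nat) (M : manifold R n)
    (nabla : forall p : M, tangent p -> vfield M -> tangent p) : Prop :=
  AffineConnection {
  connection_linear : forall (U : set M) (Y : vfield M),
    open U -> smooth_vfield U Y -> forall p, U p ->
    forall a (u v : tangent p),
      nabla p (a *: u + v) Y = a *: nabla p u Y + nabla p v Y;
  connection_add : forall (U : set M) (Y Z : vfield M),
    open U -> smooth_vfield U Y -> smooth_vfield U Z -> forall p, U p ->
    forall v : tangent p,
      nabla p v (fun q => Y q + Z q) = nabla p v Y + nabla p v Z;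
  connection_leibniz : forall (U : set M) (f : M -> R^o) (Y : vfield M),
    open U -> smooth_fun U f -> smooth_vfield U Y -> forall p, U p ->
    forall v : tangent p,
      nabla p v (fun q => f q *: Y q) = vderiv v f *: Y p + f p *: nabla p v Y;
  connection_smooth : forall (U : set M) (X Y : vfield M),
    open U -> smooth_vfield U X -> smooth_vfield U Y ->
    smooth_vfield U (fun p => nabla p (X p) Y) }.

Record levi_civita (R : realType) (n : nat) (M : manifold R n)
    (g : forall p : M, tangent p -> tangent p -> R)
    (nabla : forall p : M, tangent p -> vfield M -> tangent p) : Prop :=
  LeviCivita {
  levi_civita_connection : affine_connection nabla;
  levi_civita_torsion_free : forall (U : set M) (X Y : vfield M),
    open U -> smooth_vfield U X -> smooth_vfield U Y -> forall p, U p ->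
    nabla p (X p) Y - nabla p (Y p) X = lie_bracket X Y p;
  levi_civita_metric : forall (U : set M) (Y Z : vfield M),
    open U -> smooth_vfield U Y -> smooth_vfield U Z -> forall p, U p ->
    forall v : tangent p,
      vderiv v (fun q => g q (Y q) (Z q)) =
      g p (nabla p v Y) (Z p) + g p (Y p) (nabla p v Z) }.

Record sasakian (R : realType) (m : nat) (M : manifold R m.*2.+1) := Sasakian {
  sas_phi : forall p : M, {linear tangent p -> tangent p};
  sas_xi : vfield M;
  sas_eta : forall p : M, {scalar tangent p};
  sas_g : forall p : M, tangent p -> tangent p -> R;
  sas_nabla : forall p : M, tangent p -> vfield M -> tangent p;
  sas_phi_smooth : forall (U : set M) (X : vfield M), open U ->
    smooth_vfield U X -> smooth_vfield U (fun p => sas_phi p (X p));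
  sas_xi_smooth : smooth_vfield setT sas_xi;
  sas_eta_smooth : forall (U : set M) (X : vfield M), open U ->
    smooth_vfield U X -> smooth_fun U (fun p => sas_eta p (X p));
  sas_g_metric : riemannian_metric sas_g;
  sas_nabla_levi_civita : levi_civita sas_g sas_nabla;
  sas_phi2 : forall p (u : tangent p),
    sas_phi p (sas_phi p u) = - u + sas_eta p u *: sas_xi p;
  sas_eta_xi : forall p, sas_eta p (sas_xi p) = 1;
  sas_phi_xi : forall p, sas_phi p (sas_xi p) = 0;
  sas_compatible : forall p (u v : tangent p),
    sas_g (sas_phi p u) (sas_phi p v) = sas_g u v - sas_eta p u * sas_eta p v;
  (* (nabla_v phi) Y = nabla_v (phi Y) - phi (nabla_v Y) *)
  sas_nabla_phi : forall (U : set M) (Y : vfield M), open U ->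
    smooth_vfield U Y -> forall p, U p -> forall v : tangent p,
      sas_nabla v (fun q => sas_phi q (Y q)) - sas_phi p (sas_nabla v Y) =
      sas_g v (Y p) *: sas_xi p - sas_eta p (Y p) *: v }.

Record smooth_distribution (R : realType) (n : nat) (M : manifold R n) :=
  SmoothDistribution {
  dist_fiber :> forall p : M, {vspace tangent p};
  dist_rank : nat;
  dist_constant_rank : forall p, \dim (dist_fiber p) = dist_rank;
  dist_smooth : forall p : M, exists2 U : set M, open U /\ U p &
    exists X : 'I_dist_rank -> vfield M,
      (forall j, smooth_vfield U (X j)) /\
      (forall q, U q ->
         dist_fiber q = <<[seq X j q | j <- enum 'I_dist_rank]>>%VS) }.

(* Integrability in the infinitesimal sense (as in the books of Spivak and
   Warner): the bracket of any two local sections is again a section. *)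
Definition integrable_distribution (R : realType) (n : nat) (M : manifold R n)
    (D : smooth_distribution M) : Prop :=
  forall (U : set M) (X Y : vfield M), open U ->
    smooth_vfield U X -> smooth_vfield U Y ->
    (forall p, U p -> X p \in D p) -> (forall p, U p -> Y p \in D p) ->
    forall p, U p -> lie_bracket X Y p \in D p.

Section Submanifold.
Variables (R : realType) (m n : nat) (Mbar : manifold R m.*2.+1).
Variables (S : sasakian Mbar) (M : manifold R n) (i : M -> Mbar).

(* V lies in the normal space of M at p. *)
Definition normal_vector (p : M) (V : tangent (i p)) : Prop :=
  forall w : tangent p, sas_g S V (mdiff i w) = 0.

(* The tangential part of V, as a vector tangent to M: the unique w such that
   V - di(w) is normal. *)
Definition tangential_part (p : M) (V : tangent (i p)) : tangent p :=
  xget 0 [set w : tangent p | normal_vector (V - mdiff i w)].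

Definition P_op (p : M) (u : tangent p) : tangent p :=
  tangential_part (sas_phi S (i p) (mdiff i u)).

Record PTR_submanifold (D : smooth_distribution M) : Prop := PTRSubmanifold {
  ptr_immersion : immersion i;
  ptr_xi_tangent : forall p : M,
    exists u : tangent p, mdiff i u = sas_xi S (i p);
  ptr_nonzero : (0 < dist_rank D)%N;
  ptr_horizontal : forall (p : M) (u : tangent p),
    u \in D p -> sas_eta S (i p) (mdiff i u) = 0;
  ptr_totally_real : forall (p : M) (u : tangent p),
    u \in D p -> normal_vector (sas_phi S (i p) (mdiff i u)) }.

Definition maximal_totally_real (D : smooth_distribution M) : Prop :=
  forall (p : M) (u : tangent p),
    u \in D p <-> sas_eta S (i p) (mdiff i u) = 0 /\ P_op u = 0.

End Submanifold.

(* Main.v *)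
Require Import Defs.
From HB Require Import structures.
From mathcomp Require Import all_boot all_order all_algebra.
From mathcomp Require Import all_classical all_reals all_analysis.
From mathcomp Require Import ring lra.
Import numFieldNormedType.Exports.
Import Order.TTheory GRing.Theory Num.Theory.
Set Implicit Arguments.
Unset Strict Implicit.
Unset Printing Implicit Defensive.
Local Open Scope classical_set_scope.
Local Open Scope ring_scope.

(** The proof is exterior calculus for the 1-form [alpha = i^* eta] on [M].

    On a Sasakian manifold [nabla_v xi = - phi v] ([nabla_xi]), and since the
    Levi-Civita connection is metric and torsion free this gives
    [d eta (u, v) = 2 g (u, phi v)] ([ext_diff_eta]).  As [d] commutes with
    pull-backs ([ext_diff_pullback]),
    [d alpha (u, v) = 2 g (di u, phi (di v))] ([ext_diff_pulled_eta]).
    The form [g (., phi .)] is skew, so [d alpha (u, .) = 0] says exactly that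
    [phi (di u)] is normal to [M], that is [P u = 0].  Maximality of [D] thus
    means that [D] is the characteristic system of [alpha]: the vectors [u]
    with [alpha u = 0] and [d alpha (u, .) = 0].

    The characteristic system of any 1-form is involutive
    ([characteristic_involutive]).  For sections [X], [Y] of it,
    [alpha [X, Y] = - d alpha (X, Y) = 0]; and contracting [d (d alpha) = 0]
    with [X], [Y] and an arbitrary [v] leaves only the term
    [d alpha ([X, Y], v)].

    All of this is done in charts.  The analytic input is the symmetry of
    second derivatives ([schwarz_real]), which lies behind [d (d alpha) = 0],
    the pull-back formula and the vanishing of the bracket of two coordinate
    fields.  The exterior derivative of [eta] is only computed at the centre
    of a preferred chart, where directional derivatives of functions on the
    manifold are by definition derivatives in that chart; the pull-back
    formula carries the result to every other chart. *)

(** * Differentials and [C^k] maps as local notions *)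

Section Near.
Context {R : realType}.
Implicit Types E F : normedModType R.

(** Differentiability and the differential depend only on the germ of the map;
    this is what lets expressions in different charts be identified on the
    overlap of their domains. *)
Lemma diff_near_eq E F (f g : E -> F) x :
  (\forall y \near x, f y = g y) -> differentiable f x ->
  differentiable g x /\ 'd g x = 'd f x :> (E -> F).
Proof.
move=> fg df.
have [dc dE] := (diff_locallyxP x f).1 df.
have fgx : f x = g x by exact: nbhs_singleton fg.
have gE : g \o shift x = cst (g x) + 'd f x +o_ 0 id.
  have /eqaddoP H := diff_locally df.
  apply/eqaddoP => e e0; have := H e e0; apply: filter_app.
  have /= : \forall y \near 0, f (y + x) = g (y + x).
    by have := fg; rewrite (near_shift 0) /= subr0.
  by apply: filterS => y; rewrite /= !fctE /= fgx => ->.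
have dgE := diff_unique dc gE.
split; [apply/diff_locallyP; rewrite dgE; split; [exact: dc|exact: gE]|exact: dgE].
Qed.

Lemma Ck_sub E F k (U V : set E) (f : E -> F) :
  V `<=` U -> Ck k U f -> Ck k V f.
Proof.
move=> VU; elim: k f => [|k IH] f /=; first by move=> fc x /VU /fc.
by move=> [df dkf]; split=> [x /VU /df //|v]; apply: IH.
Qed.

Lemma Ck_eq E F k (U : set E) (f g : E -> F) : open U ->
  (forall x, U x -> f x = g x) -> Ck k U f -> Ck k U g.
Proof.
move=> oU.
have near_eq (h1 h2 : E -> F) x : (forall x, U x -> h1 x = h2 x) -> U x ->
    \forall y \near x, h1 y = h2 y.
  by move=> h12 Ux; apply: filterS (open_nbhs_nbhs (conj oU Ux)) => y /h12.
elim: k f g => [|k IH] f g fg /=.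
  move=> fc x Ux; rewrite /prop_for /continuous_at -fg //.
  apply: cvg_trans (fc x Ux); apply: near_eq_cvg.
  exact: near_eq.
move=> [df dkf]; split=> [x Ux|v].
  by have [] := diff_near_eq (near_eq _ _ _ fg Ux) (df x Ux).
apply: IH (dkf v) => x Ux.
by have [_ ->] := diff_near_eq (near_eq _ _ _ fg Ux) (df x Ux).
Qed.

Lemma CkW E F k (U : set E) (f : E -> F) : Ck k.+1 U f -> Ck k U f.
Proof.
elim: k f => [|k IH] f /= [df dkf].
  by move=> x Ux; apply/differentiable_continuous/df.
by split=> // v; apply: IH.
Qed.

End Near.

(** * Closure properties of [C^k] maps *)

Section CkAlgebra.
Context {R : realType}.
Implicit Types E F G : normedModType R.

Lemma Ck_cst E F k (U : set E) (a : F) : Ck k U (fun=> a).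
Proof.
elim: k a => [|k IH] a /=; first by move=> x _; exact: cst_continuous.
split=> [x _|v]; first exact: differentiable_cst.
have -> : (fun x : E => 'd (fun=> a) x v) = (fun=> 0 : F).
  by apply/funext => x; have := diff_cst a x; rewrite /cst => ->.
exact: IH.
Qed.

Lemma Ck_add E F k (U : set E) (f g : E -> F) : open U ->
  Ck k U f -> Ck k U g -> Ck k U (fun x => f x + g x).
Proof.
move=> oU; elim: k f g => [|k IH] f g /=.
  by move=> fc gc x Ux; apply: continuousD; [exact: fc|exact: gc].
move=> [df dkf] [dg dkg]; split=> [x Ux|v].
  by apply: differentiableD; [exact: df|exact: dg].
apply: (Ck_eq oU _ (IH _ _ (dkf v) (dkg v))) => x Ux.
by have := diffD (df x Ux) (dg x Ux) => /(congr1 (@^~ v)) /= <-.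
Qed.

Lemma Ck_sum E F k (U : set E) (I : finType) (f : I -> E -> F) : open U ->
  (forall j, Ck k U (f j)) -> Ck k U (fun x => \sum_j f j x).
Proof.
move=> oU fk.
have -> : (fun x => \sum_j f j x) = \sum_j f j.
  by apply/funext => x; rewrite fct_sumE.
elim/big_ind : _ => //; first exact: Ck_cst.
by move=> g h; exact: Ck_add.
Qed.

Lemma Ck_mul E k (U : set E) (f g : E -> R^o) : open U ->
  Ck k U f -> Ck k U g -> Ck k U (fun x => f x * g x : R^o).
Proof.
move=> oU; elim: k f g => [|k IH] f g.
  by move=> /= fc gc x Ux; apply: continuousM; [exact: fc|exact: gc].
move=> fk gk; have fk' := CkW fk; have gk' := CkW gk.
case: fk gk => [df dkf] [dg dkg]; split=> [x Ux|v].
  exact: (differentiableM (df x Ux) (dg x Ux)).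
apply: (Ck_eq oU _ (Ck_add oU (IH _ _ fk' (dkg v)) (IH _ _ gk' (dkf v)))).
move=> x Ux.
exact: (esym (congr1 (@^~ v) (diffM (df x Ux) (dg x Ux)))).
Qed.

Lemma Ck_linear_comp E F G k (U : set E) (L : {linear F -> G}) (f : E -> F) :
  open U -> continuous L -> Ck k U f -> Ck k U (fun x => L (f x)).
Proof.
move=> oU Lc; elim: k f => [|k IH] f /=.
  by move=> fc x Ux; apply: continuous_comp; [exact: fc|exact: Lc].
have dL y : differentiable L y by exact: linear_differentiable.
move=> [df dkf]; split=> [x Ux|v].
  by apply: (differentiable_comp (df x Ux)).
apply: (Ck_eq oU _ (IH _ (dkf v))) => x Ux.
have := diff_comp (df x Ux) (dL (f x)) => /(congr1 (@^~ v)).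
by rewrite /comp (diff_lin _ Lc) => <-.
Qed.

End CkAlgebra.

Section Rows.
Context {R : realType}.
Implicit Types E F G : normedModType R.

(** The target is [R^o], on which both [Ck] and the ring operations are
    available; it is declared linear below so that [Ck_linear_comp] applies. *)
Definition row_coord n (j : 'I_n) (v : 'rV[R]_n) : R^o :=
  v ord0 j.

Lemma row_coord_linear n (j : 'I_n) : linear (@row_coord n j).
Proof. by move=> a u v; rewrite /row_coord !mxE. Qed.

HB.instance Definition _ n (j : 'I_n) :=
  GRing.isLinear.Build R 'rV[R]_n R^o _ (@row_coord n j) (row_coord_linear j).

Lemma row_coord_continuous n (j : 'I_n) : continuous (@row_coord n j).
Proof. exact: coord_continuous. Qed.

Lemma Ck_row_coord E n k (U : set E) (f : E -> 'rV[R]_n) (j : 'I_n) : open U ->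
  Ck k U f -> Ck k U (fun x => row_coord j (f x)).
Proof.
move=> oU fk; apply: (@Ck_linear_comp _ _ _ _ _ _ (row_coord j)) => //.
exact: row_coord_continuous.
Qed.

Lemma row_coordE n (v : 'rV[R]_n) : v = \sum_j row_coord j v *: delta_mx ord0 j.
Proof. by rewrite {1}(row_sum_delta v). Qed.

Lemma linear_sum_coord n (F : lmodType R) (L : 'rV[R]_n -> F) v :
  (forall a u w, L (a *: u + w) = a *: L u + L w) ->
  L v = \sum_j row_coord j v *: L (delta_mx ord0 j).
Proof.
move=> Llin.
pose LM := GRing.isLinear.Build _ _ _ _ L Llin.
pose L' : {linear _ -> _} := HB.pack L LM.
rewrite -[L]/(L' : _ -> _) {1}(row_coordE v) linear_sum.
by apply: eq_bigr => j _; rewrite linearZ.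
Qed.

Lemma Ck_coordP E n k (U : set E) (f : E -> 'rV[R]_n) : open U ->
  (forall j, Ck k U (fun x => row_coord j (f x))) -> Ck k U f.
Proof.
move=> oU fk; pose L j (a : R^o) : 'rV[R]_n := a *: delta_mx ord0 j.
have Llin j : linear (L j) by move=> a u v; rewrite /L scalerDl scalerA.
pose LL j : {linear _ -> _} :=
  HB.pack (L j) (GRing.isLinear.Build _ _ _ _ (L j) (Llin j)).
apply: (@Ck_eq _ _ _ _ _ (fun x => \sum_j LL j (row_coord j (f x)))) => //.
  by move=> x _; rewrite -row_coordE.
apply: Ck_sum => // j; apply: Ck_linear_comp => //.
exact: scalel_continuous.
Qed.

(** [Ck] only speaks of derivatives in constant directions, while the chain rule
    differentiates [g] in the moving direction ['d f x v].  Expanding that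
    direction on the standard basis turns the derivative of the composite into
    a sum of products of functions covered by the induction hypothesis. *)
Lemma Ck_comp E n k (U : set E) (V : set 'rV[R]_n) (f : E -> 'rV[R]_n)
    (g : 'rV[R]_n -> R^o) :
  open U -> (forall x, U x -> V (f x)) ->
  Ck k U f -> Ck k V g -> Ck k U (fun x => g (f x)).
Proof.
move=> oU UV; elim: k f g UV => [|k IH] f g UV.
  by move=> fc gc x Ux; apply: continuous_comp; [exact: fc|exact/gc/UV].
move=> fk [dg dkg]; have fk' := CkW fk; case: fk => [df dkf].
split=> [x Ux|v].
  exact: (differentiable_comp (df x Ux) (dg _ (UV _ Ux))).
pose h x := \sum_j (row_coord j ('d f x v) * 'd g (f x) (delta_mx ord0 j) : R^o).
apply: (@Ck_eq _ _ _ _ _ h) => //.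
  move=> x Ux; have := diff_comp (df x Ux) (dg _ (UV _ Ux)).
  move=> /(congr1 (@^~ v)); rewrite /comp => ->.
  rewrite (@linear_sum_coord _ _ ('d g (f x)) ('d f x v)) => [//|a u w].
  exact: linearP.
apply: Ck_sum => // j; apply: Ck_mul => //.
  exact: Ck_row_coord (dkf v).
exact: (IH _ _ UV fk' (dkg _)).
Qed.

Lemma Ck_comp_rV E n m k (U : set E) (V : set 'rV[R]_n) (f : E -> 'rV[R]_n)
    (g : 'rV[R]_n -> 'rV[R]_m) :
  open U -> open V -> (forall x, U x -> V (f x)) ->
  Ck k U f -> Ck k V g -> Ck k U (fun x => g (f x)).
Proof.
move=> oU oV UV fk gk; apply: Ck_coordP => // j.
apply: (@Ck_comp _ _ _ _ V _ (fun y => row_coord j (g y))) => //.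
exact: Ck_row_coord.
Qed.

End Rows.

(** * Symmetry of second derivatives *)

Section Schwarz.
Context {R : realType}.
Implicit Types E F : normedModType R.

Lemma mvt_line E (F : E -> R^o) (y v : E) (h : R) : 0 < h ->
  (forall t : R, 0 <= t <= h -> differentiable F (y + t *: v)) ->
  exists2 t, 0 <= t <= h & F (y + h *: v) - F y = h * 'd F (y + t *: v) v.
Proof.
move=> h0 dF.
pose l (t : R) : E := y + t *: v.
have dl t : is_diff t l (fun s : R => s *: v).
  rewrite /l; have -> : (fun s : R => s *: v) = 0 + (fun s : R => s *: v).
    by apply/funext => s; rewrite fctE /= add0r.
  exact: is_diffD.
have dFl t : 0 <= t <= h -> is_derive t 1 (F \o l) ('d F (l t) v).
  move=> th; have dFt := dF t th.
  have dlt : differentiable l t by have [] := dl t.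
  have dc : differentiable (F \o l) t by exact: differentiable_comp.
  apply: DeriveDef; first exact: diff_derivable.
  rewrite deriveE // diff_comp //= (@diff_val _ _ _ _ _ _ _ (dl t)).
  by rewrite scale1r.
have [||t th] := @MVT _ (F \o l) (fun t => 'd F (l t) v) 0 h h0.
- move=> t; rewrite in_itv /= => /andP[t0 th]; apply: dFl.
  by rewrite !ltW.
- apply: continuous_in_subspaceT => t; rewrite inE /= in_itv /= => th.
  apply: differentiable_continuous.
  by apply: differentiable_comp; [have [] := dl t|exact: dF].
- rewrite /l /= scale0r addr0 subr0 mulrC => Fh.
  exists t => //; move: th; rewrite in_itv /= => /andP[t0 th].
  by rewrite !ltW.
Qed.

(** Two applications of the mean value theorem: first along [v], to the
    increment of [g] by [h w], then along [w], to the derivative of [g] in the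
    direction [v].  The left-hand side is symmetric in [v] and [w], so it also
    equals [h ^+ 2] times a value of the other mixed derivative. *)
Lemma second_difference E (g : E -> R^o) (U : set E) (x v w : E) (h : R) :
  0 < h -> Ck 2 U g ->
  (forall t s : R, 0 <= t <= h -> 0 <= s <= h -> U (x + t *: v + s *: w)) ->
  exists t s, [/\ 0 <= t <= h, 0 <= s <= h &
    g (x + h *: v + h *: w) - g (x + h *: v) - (g (x + h *: w) - g x) =
    h * (h * 'd (fun z => 'd g z v) (x + t *: v + s *: w) w)].
Proof.
move=> h0 [dg d2g] Uh.
have h00 : 0 <= (0 : R) <= h by rewrite lexx ltW.
have hh : 0 <= h <= h by rewrite lexx ltW.
pose c := h *: w.
have dsh z : U (z + c) -> is_diff z (fun y => g (y + c)) ('d g (z + c)).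
  move=> Uz; have H : is_diff z (fun y => y + c) id.
    by rewrite -[X in is_diff _ _ X]addr0; exact: is_diffD.
  rewrite -[X in is_diff _ _ X]/('d g (z + c) \o id).
  apply: (@is_diff_comp _ _ _ _ (fun y => y + c) id g) => //.
  exact/differentiableP/dg.
have dF t : 0 <= t <= h ->
    is_diff (x + t *: v) (fun z => g (z + c) - g z)
      (fun u => 'd g (x + t *: v + c) u - 'd g (x + t *: v) u).
  move=> th; apply: (is_diffB (dsh _ _)); first exact: Uh.
  by apply/differentiableP/dg; have := Uh t 0 th h00; rewrite scale0r addr0.
have [|t th ->] := @mvt_line _ (fun z => g (z + c) - g z) x v h h0.
  by move=> t th; have [] := dF t th.
rewrite (@diff_val _ _ _ _ _ _ _ (dF t th)).
have [|s sh Hs] := @mvt_line _ (fun z => 'd g z v) (x + t *: v) w h h0.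
  by move=> s sh; have [H _] := d2g v; apply/H/Uh.
by exists t, s; split => //; rewrite -Hs.
Qed.

(** By [second_difference] the two mixed derivatives take a common value, at two
    points as close to [x] as wanted; continuity of both then forbids a gap
    between their values at [x]. *)
Lemma schwarz_real E (g : E -> R^o) (U : set E) (x v w : E) : open U ->
  Ck 2 U g -> U x ->
  'd (fun z => 'd g z v) x w = 'd (fun z => 'd g z w) x v.
Proof.
move=> oU g2 Ux.
set A := fun v w x => 'd (fun z => 'd g z v) x w.
rewrite -[LHS]/(A v w x) -[RHS]/(A w v x).
have Ac v' w' : {for x, continuous (A v' w' : E -> R^o)}.
  by case: (g2) => _ /(_ v') [_ /(_ w') /(_ _ Ux)].
apply/eqP; apply/negPn/negP => AB.
pose e := `|A v w x - A w v x| / 2.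
have e0 : 0 < e by rewrite divr_gt0 // normr_gt0 subr_eq0.
have near_good : \forall y \near x,
    [/\ U y, `|A v w x - A v w y| < e & `|A w v x - A w v y| < e].
  have /cvgrPdist_lt/(_ _ e0) H1 := Ac v w.
  have /cvgrPdist_lt/(_ _ e0) H2 := Ac w v.
  near=> y; split; near: y => //.
  exact: (open_nbhs_nbhs (conj oU Ux)).
move: near_good => /nbhs_ballP[d /= d0 good].
(* the whole parallelogram of sides h v and h w at x must stay in the ball *)
pose h := d / (`|v| + `|w| + 1).
have nvw : 0 < `|v| + `|w| + 1 by rewrite ltr_wpDl // addr_ge0.
have h0 : 0 < h by rewrite divr_gt0.
have inball (t s : R) : 0 <= t <= h -> 0 <= s <= h -> ball x d (x + t *: v + s *: w).
  move=> /andP[t0 th] /andP[s0 sh]; rewrite -ball_normE /= -addrA opprD addNKr.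
  rewrite normrN (le_lt_trans (ler_normD _ _)) // !normrZ !ger0_norm //.
  apply: (@le_lt_trans _ _ (h * `|v| + h * `|w|)).
    by apply: lerD; apply: ler_wpM2r.
  rewrite -mulrDr /h -mulrA gtr_pMr // mulrC ltr_pdivrMr // mul1r.
  by rewrite ltrDl.
have [t [s [th sh E1]]] := second_difference (x := x) (v := v) (w := w) h0 g2
  (fun t s th sh => let: And3 Uy _ _ := good _ (inball t s th sh) in Uy).
have inball' (t' s' : R) : 0 <= t' <= h -> 0 <= s' <= h ->
    ball x d (x + t' *: w + s' *: v).
  by move=> th' sh'; rewrite addrAC; exact: inball.
have [t' [s' [th' sh' E2]]] := second_difference (x := x) (v := w) (w := v) h0 g2
  (fun t s th sh => let: And3 Uy _ _ := good _ (inball' t s th sh) in Uy).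
have AA : A v w (x + t *: v + s *: w) = A w v (x + t' *: w + s' *: v).
  have hN0 : h != 0 by rewrite gt_eqF.
  apply/(mulfI hN0)/(mulfI hN0); rewrite -E1 -E2.
  rewrite (addrAC x (h *: w)); ring.
have [_ H1 _] := good _ (inball t s th sh).
have [_ _ H2] := good _ (inball' t' s' th' sh').
have : `|A v w x - A w v x| < e + e.
  rewrite (le_lt_trans _ (ltrD H1 H2)) // AA [X in _ <= _ + X]distrC.
  exact: ler_distD.
by rewrite /e -splitr ltxx.
Unshelve. all: by end_near. Qed.

End Schwarz.

(** * One-forms on coordinate space *)

Section Forms.
Context {R : realType}.
Implicit Types E F : normedModType R.

Lemma diff_row_coord E n (f : E -> 'rV[R]_n) (j : 'I_n) (x u : E) :
  differentiable f x ->
  differentiable (fun y => row_coord j (f y)) x /\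
  'd (fun y => row_coord j (f y)) x u = row_coord j ('d f x u).
Proof.
move=> df; have cj := @row_coord_continuous R n j.
have dj : differentiable (@row_coord R n j) (f x) by exact: linear_differentiable.
split; first exact: (differentiable_comp df dj).
have /(congr1 (@^~ u)) := diff_comp df dj.
by rewrite /comp (diff_lin _ cj).
Qed.

Lemma schwarz_rV E n (f : E -> 'rV[R]_n) (U : set E) (x v w : E) : open U ->
  Ck 2 U f -> U x ->
  'd (fun z => 'd f z v) x w = 'd (fun z => 'd f z w) x v.
Proof.
move=> oU f2 Ux; apply/rowP => j.
have [df d2f] := f2.
have E2 v' w' : 'd (fun z => 'd (fun y => row_coord j (f y)) z v') x w' =
    row_coord j ('d (fun z => 'd f z v') x w').
  have [dv _] := d2f v'.
  have [d1 <-] := diff_row_coord j w' (dv x Ux).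
  have ne : \forall z \near x,
      row_coord j ('d f z v') = 'd (fun y => row_coord j (f y)) z v'.
    apply: filterS (open_nbhs_nbhs (conj oU Ux)) => z Uz.
    by have [_ ->] := diff_row_coord j v' (df z Uz).
  by have [_ ->] := diff_near_eq ne d1.
rewrite -[LHS]/(row_coord j _) -[RHS]/(row_coord j _) -!E2.
exact: (schwarz_real v w oU (Ck_row_coord j oU f2) Ux).
Qed.

(** A 1-form is a map [e] taking a vector first and a point second, so that
    [e w] is the component function of the form on the constant field [w]. *)
Definition linear_at n E (e : 'rV[R]_n -> E -> R^o) (y : E) :=
  forall (k : R) u w, e (k *: u + w) y = k * e u y + e w y.

Lemma linear_at_sum n E (e : 'rV[R]_n -> E -> R^o) (y : E) u : linear_at e y ->
  e u y = \sum_j row_coord j u * e (delta_mx ord0 j) y.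
Proof. by move=> el; exact: (@linear_sum_coord _ _ R^o (e^~ y)). Qed.

Lemma linear_at_diff n E (e : 'rV[R]_n -> E -> R^o) (x h : E) :
  (\forall y \near x, linear_at e y) -> (forall w, differentiable (e w) x) ->
  linear_at (fun w y => 'd (e w) y h) x.
Proof.
move=> elin de k u w.
have d1 : differentiable (k *: e u) x by exact: differentiableZ.
have d2 : differentiable (k *: e u + e w) x by exact: differentiableD.
have ne : \forall y \near x, (k *: e u + e w) y = e (k *: u + w) y.
  by apply: filterS elin => y ey; rewrite ey.
have [_ /(congr1 (@^~ h)) E1] := diff_near_eq ne d2.
have /(congr1 (@^~ h)) E2 := diffD d1 (de w).
have /(congr1 (@^~ h)) E3 := diffZ k (de u).
exact: (etrans E1 (etrans E2 (congr1 (+%R^~ _) E3))).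
Qed.

Lemma diff_sum E F n (f : 'I_n -> E -> F) (x h : E) :
  (forall j, differentiable (f j) x) ->
  'd (\sum_j f j) x h = \sum_j 'd (f j) x h.
Proof.
move=> df.
have [] : differentiable (\sum_j f j) x /\
    'd (\sum_j f j) x h = \sum_j 'd (f j) x h; last by [].
elim/big_rec2 : _ => [|j s g _ [dg IH]].
  by split; [exact: differentiable_cst|rewrite (diff_cst (0 : F))].
split; first exact: differentiableD.
have /(congr1 (@^~ h)) E1 := diffD (df j) dg.
exact: (etrans E1 (congr1 (+%R _) IH)).
Qed.

(** Leibniz rule for the value of a 1-form on a moving vector: differentiate
    once with the vector frozen and once with the form frozen. *)
Lemma diff_form_apply n E (e : 'rV[R]_n -> E -> R^o) (A : E -> 'rV[R]_n) (x h : E) :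
  (\forall y \near x, linear_at e y) -> (forall w, differentiable (e w) x) ->
  differentiable A x ->
  differentiable (fun y => e (A y) y : R^o) x /\
  'd (fun y => e (A y) y : R^o) x h = 'd (e (A x)) x h + e ('d A x h) x.
Proof.
move=> elin de dA.
have dAj j : differentiable (fun y => row_coord j (A y)) x.
  by have [] := diff_row_coord j h dA.
pose t j : E -> R^o := (fun y => row_coord j (A y)) * e (delta_mx ord0 j).
have dt j : differentiable (t j) x by exact: differentiableM.
have dst := differentiable_sum dt.
have st : \forall y \near x, (\sum_j t j) y = e (A y) y.
  by apply: filterS elin => y ey; rewrite (linear_at_sum _ ey) fct_sumE.
have [dS /(congr1 (@^~ h)) E1] := diff_near_eq st dst; split; first exact: dS.
apply: (etrans E1); rewrite (diff_sum h dt).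
rewrite (linear_at_sum _ (nbhs_singleton elin)).
rewrite (linear_at_sum (e := fun w y => 'd (e w) y h) _ (linear_at_diff h elin de)).
rewrite -big_split; apply: eq_bigr => j _.
have /(congr1 (@^~ h)) E2 := diffM (dAj j) (de (delta_mx ord0 j)).
apply: (etrans E2); rewrite -(diff_row_coord j h dA).2.
exact: (congr1 (+%R _) (mulrC _ _)).
Qed.

End Forms.

(** * The exterior derivative and characteristic systems *)

Section ExteriorDerivative.
Context {R : realType}.

(** The bracket term of the invariant formula is absent because [u] and [v]
    are extended to constant fields. *)
Definition ext_diff n (a : 'rV[R]_n -> 'rV[R]_n -> R^o) (x u v : 'rV[R]_n) : R :=
  'd (a v) x u - 'd (a u) x v.

(** The derivative of [e ('d f y v) (f y)] has one term with the derivative of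
    [e], which is the pull-back of [d e], and one with the second derivative of
    [f]; the latter is symmetric and cancels in the antisymmetrisation. *)
Lemma ext_diff_pullback n m (f : 'rV[R]_n -> 'rV[R]_m) (U : set 'rV[R]_n)
    (e : 'rV[R]_m -> 'rV[R]_m -> R^o) (a : 'rV[R]_n -> 'rV[R]_n -> R^o) x :
  open U -> Ck 2 U f -> U x ->
  (\forall y \near f x, linear_at e y) ->
  (forall w, differentiable (e w) (f x)) ->
  (forall w, \forall y \near x, e ('d f y w) (f y) = a w y) ->
  forall u v, ext_diff a x u v = ext_diff e (f x) ('d f x u) ('d f x v).
Proof.
move=> oU f2 Ux elin de ae u v; have [df d2f] := f2.
have dfx := df x Ux.
pose e' w y := e w (f y).
have e'lin : \forall y \near x, linear_at e' y.
  exact: (differentiable_continuous dfx elin).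
have de' w : differentiable (e' w) x by exact: (differentiable_comp dfx (de w)).
have dae v' u' : 'd (a v') x u' = 'd (e ('d f x v')) (f x) ('d f x u') +
    e ('d (fun y => 'd f y v') x u') (f x).
  have [dv _] := d2f v'.
  have [d1 E1] := diff_form_apply u' e'lin de' (dv x Ux).
  have [_ /(congr1 (@^~ u')) E2] := diff_near_eq (ae v') d1.
  apply: (etrans E2); apply: (etrans E1); apply: (congr1 (+%R^~ _)).
  exact: (congr1 (@^~ u') (diff_comp dfx (de _))).
apply: (etrans (congr2 (fun r s => r - s) (dae v u) (dae u v))).
have cancel (r s : R^o) p q : p = q ->
    r + e p (f x) - (s + e q (f x)) = r - s.
  by move=> ->; rewrite opprD addrACA subrr addr0.
exact: cancel (schwarz_rV v u oU f2 Ux).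
Qed.

(** [Z] is the bracket of [X] and [Y].  Differentiating [a (X) = 0] along [Y]
    and [a (Y) = 0] along [X] and subtracting gives [a (Z) = - d a (X, Y) = 0].
    In the same way [d a (X, v) = 0] and [d a (Y, v) = 0] express
    [d a (Z, v)] by derivatives of [d a] along [X] and [Y] with frozen
    arguments; since [d (d a) = 0], these add up to a derivative along [v] of
    [d a (X, Y)], which vanishes because [d a (Y, .) = 0] identically. *)
Lemma characteristic_involutive n (a : 'rV[R]_n -> 'rV[R]_n -> R^o)
    (U : set 'rV[R]_n) (X Y : 'rV[R]_n -> 'rV[R]_n) : open U ->
  (forall x, U x -> linear_at a x) -> (forall w, Ck 2 U (a w)) ->
  (forall x, U x -> differentiable X x) ->
  (forall x, U x -> differentiable Y x) ->
  (forall x, U x -> a (X x) x = 0 /\ forall v, ext_diff a x (X x) v = 0) ->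
  (forall x, U x -> a (Y x) x = 0 /\ forall v, ext_diff a x (Y x) v = 0) ->
  forall x, U x -> let Z := 'd Y x (X x) - 'd X x (Y x) in
    a Z x = 0 /\ forall v, ext_diff a x Z v = 0.
Proof.
move=> oU alin a2 dX dY aX aY x Ux Z.
have nearU (P : _ -> Prop) : (forall y, U y -> P y) -> \forall y \near x, P y.
  by move=> UP; apply: filterS (open_nbhs_nbhs (conj oU Ux)) => y /UP.
have da w y : U y -> differentiable (a w) y by move=> Uy; have [H _] := a2 w; exact: H.
have alin_x := nearU _ alin.
have extlin v : forall y, U y -> linear_at (fun w y => ext_diff a y w v : R^o) y.
  move=> y Uy k u w.
  have aliny : \forall y' \near y, linear_at a y'.
    by apply: filterS (open_nbhs_nbhs (conj oU Uy)) => z /alin.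
  have E1 := linearP ('d (a v) y) k u w.
  have E2 := linear_at_diff v aliny (fun w => da w y Uy) k u w.
  apply: (etrans (congr2 (fun r s => r - s) E1 E2)).
  have ringE (p q r s : R) : (k * p + q) - (k * r + s) = k * (p - r) + (q - s).
    by ring.
  exact: ringE.
have d2a w h : differentiable (fun y => 'd (a w) y h) x.
  by have [_ /(_ h) [H _]] := a2 w; exact: H.
have dext w v : differentiable (fun y => ext_diff a y w v : R^o) x.
  exact: (differentiableB (d2a v w) (d2a w v)).
have dextE w v h : 'd (fun y => ext_diff a y w v : R^o) x h =
    'd (fun y => 'd (a v) y w) x h - 'd (fun y => 'd (a w) y v) x h.
  exact: (congr1 (@^~ h) (diffB (d2a v w) (d2a w v))).
(* d (d a) = 0, by the symmetry of the second derivatives of each a w *)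
have closed p q r : 'd (fun y => ext_diff a y p q : R^o) x r +
    'd (fun y => ext_diff a y q r : R^o) x p +
    'd (fun y => ext_diff a y r p : R^o) x q = 0.
  have S w h k := schwarz_real h k oU (a2 w) Ux.
  have ringE (A A' B B' C C' : R) : A = A' -> B = B' -> C = C' ->
    (A - B) + (C - A') + (B' - C') = 0 by move=> -> -> ->; ring.
  have E1 := dextE p q r; have E2 := dextE q r p; have E3 := dextE r p q.
  apply: (etrans (congr2 (fun s t => s + t) (congr2 (fun s t => s + t) E1 E2) E3)).
  exact: ringE (S q p r) (S p q r) (S r q p).
have zero_diff (F : 'rV[R]_n -> R^o) h : (forall y, U y -> F y = 0) -> 'd F x h = 0.
  move=> F0; have n0 : \forall y \near x, (0 : R^o) = F y.
    by apply: nearU => y /F0 ->.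
  have [_ /(congr1 (@^~ h)) E] := diff_near_eq n0 (differentiable_cst (0 : R^o) x).
  exact: (etrans E (congr1 (@^~ h) (diff_cst (0 : R^o) x))).
have aW W h : (forall y, U y -> differentiable W y) ->
    (forall y, U y -> a (W y) y = 0) ->
    'd (a (W x)) x h + a ('d W x h) x = 0.
  move=> dW W0.
  have [_ E] := diff_form_apply h alin_x (fun w => da w x Ux) (dW x Ux).
  exact: (etrans (esym E) (zero_diff _ h W0)).
have extW W v h : (forall y, U y -> differentiable W y) ->
    (forall y, U y -> ext_diff a y (W y) v = 0) ->
    'd (fun y => ext_diff a y (W x) v : R^o) x h + ext_diff a x ('d W x h) v = 0.
  move=> dW W0.
  have [_ E] := diff_form_apply h (nearU _ (extlin v)) (fun w => dext w v) (dW x Ux).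
  exact: (etrans (esym E) (zero_diff _ h W0)).
have linB (F : 'rV[R]_n -> 'rV[R]_n -> R^o) y u w :
    linear_at F y -> F (u - w) y = F u y - F w y.
  move=> Fl; have := Fl (-1) w u.
  by rewrite scaleN1r addrC mulN1r => ->; exact: addrC.
have anti y u w : ext_diff a y u w = - ext_diff a y w u by rewrite /ext_diff opprB.
have dXx := aW X _ dX (fun y Uy => (aX y Uy).1).
have dYx := aW Y _ dY (fun y Uy => (aY y Uy).1).
have eX v h := extW X v h dX (fun y Uy => (aX y Uy).2 v).
have eY v h := extW Y v h dY (fun y Uy => (aY y Uy).2 v).
split=> [|v].
  apply: (etrans (linB a x _ _ (alin x Ux))).
  have E0 : 'd (a (Y x)) x (X x) - 'd (a (X x)) x (Y x) = 0 := (aX x Ux).2 (Y x).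
  have combine (p q r s : R) : p - q = 0 -> q + s = 0 -> p + r = 0 -> r - s = 0.
    by clear; lra.
  exact: combine E0 (dXx (Y x)) (dYx (X x)).
apply: (etrans (linB (fun w y => ext_diff a y w v) x _ _ (extlin v x Ux))).
(* d a (Y, X) differentiated along v with the second argument frozen at X x:
   the term with the derivative of X would be a value of d a (Y, .), so zero *)
have E2 := eY (X x) v.
have E2' : ext_diff a x ('d Y x v) (X x) = 0.
  by apply: (etrans (anti _ _ _)); rewrite (aX x Ux).2 oppr0.
have E3 : 'd (fun y => ext_diff a y v (Y x) : R^o) x (X x) =
    - 'd (fun y => ext_diff a y (Y x) v : R^o) x (X x).
  apply: (etrans (dextE _ _ _)).
  exact: (etrans (esym (opprB _ _)) (congr1 -%R (esym (dextE _ _ _)))).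
have combine (A1 A2 A3 B C r s : R) : A1 + A2 + A3 = 0 -> A3 + B = 0 -> B = 0 ->
  A2 = - C -> A1 + s = 0 -> C + r = 0 -> r - s = 0 by clear; lra.
exact: combine (closed (X x) v (Y x)) E2 E2' E3 (eX v (Y x)) (eY v (X x)).
Qed.

End ExteriorDerivative.

(** * Changes of charts *)

Section Charts.
Context {R : realType}.

Lemma chart_image_near n (T : topologicalType) (c : chart R n T) (U : set T) p :
  chart_dom c p -> nbhs p U ->
  \forall x \near c p, exists2 q, chart_dom c q /\ U q & c q = x.
Proof.
move=> cp Up.
have icp : (c @` chart_dom c) (c p) by exists p.
have H1 := open_nbhs_nbhs (conj (chart_img_open (c := c)) icp).
have H2 : \forall x \near c p, U (chart_inv c x).
  by apply: chart_inv_continuous => //; rewrite chart_mapK.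
apply: filterS2 H1 H2 => x [q cq <-]; rewrite chart_mapK // => Uq.
by exists q.
Qed.

Lemma chart_image_open n (T : topologicalType) (c : chart R n T) (U : set T) :
  open U -> open (c @` (chart_dom c `&` U)).
Proof.
move=> oU; rewrite openE => _ [p [cp Up] <-].
by apply: (chart_image_near cp); exact: open_nbhs_nbhs.
Qed.

Lemma smooth_map_id n (M : manifold R n) : smooth_map (fun p : M => p).
Proof.
by split=> [p|c d ac ad]; [exact: cvg_id|exact: atlas_compatible].
Qed.

Section LocalExpression.
Variables (n m : nat) (N : manifold R n) (M : manifold R m) (i : N -> M).
Hypothesis si : smooth_map i.
Variables (c : chart R n N) (d : chart R m M).
Hypotheses (ac : atlas c) (ad : atlas d).

Lemma local_expr_open : open (c @` (chart_dom c `&` i @^-1` chart_dom d)).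
Proof.
apply: chart_image_open; apply: open_comp (chart_dom_open d) => p _.
exact: si.1.
Qed.

Lemma local_expr_diff p : chart_dom c p -> chart_dom d (i p) ->
  differentiable (d \o i \o chart_inv c) (c p).
Proof. by move=> cp dp; have [H _] := si.2 c d ac ad 1; apply: H; exists p. Qed.

Lemma local_expr_near p : chart_dom c p -> chart_dom d (i p) ->
  \forall x \near c p, exists2 q, chart_dom c q /\ chart_dom d (i q) & c q = x.
Proof.
move=> cp dp; apply: (chart_image_near (U := i @^-1` chart_dom d) cp).
apply: (si.1 p); exact: open_nbhs_nbhs (conj (chart_dom_open d) dp).
Qed.

End LocalExpression.

(** With [i] or [j] the identity this is the transformation rule of tangent
    vectors and of differentials under a change of chart. *)
Lemma local_expr_chain n m l (N : manifold R n) (M : manifold R m)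
    (L : manifold R l) (i : N -> M) (j : M -> L)
    (c : chart R n N) (d : chart R m M) (e : chart R l L) p v :
  smooth_map i -> smooth_map j -> atlas c -> atlas d -> atlas e ->
  chart_dom c p -> chart_dom d (i p) -> chart_dom e (j (i p)) ->
  'd (e \o j \o chart_inv d) (d (i p)) ('d (d \o i \o chart_inv c) (c p) v) =
  'd (e \o (j \o i) \o chart_inv c) (c p) v.
Proof.
move=> si sj ac ad ae cp dp ep.
have d1 := local_expr_diff si ac ad cp dp.
have d2 := local_expr_diff sj ad ae dp ep.
have fE : (d \o i \o chart_inv c) (c p) = d (i p) by rewrite /= chart_mapK.
rewrite -fE in d2 *.
have ne : \forall x \near c p,
    ((e \o j \o chart_inv d) \o (d \o i \o chart_inv c)) x =
    (e \o (j \o i) \o chart_inv c) x.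
  apply: filterS (local_expr_near si cp dp) => _ [q [cq dq] <-].
  by rewrite /= !chart_mapK.
have [_ /(congr1 (@^~ v)) ->] := diff_near_eq ne (differentiable_comp d1 d2).
exact: esym (congr1 (@^~ v) (diff_comp d1 d2)).
Qed.

Section OneManifold.
Variables (n : nat) (M : manifold R n).

Lemma diff_chart_id (c : chart R n M) (p : M) v : atlas c -> chart_dom c p ->
  'd (c \o chart_inv c) (c p) v = v.
Proof.
move=> ac cp.
have ne : \forall x \near c p, x = (c \o chart_inv c) x.
  apply: filterS (local_expr_near (smooth_map_id M) cp cp) => _ [q [cq _] <-].
  by rewrite /= chart_mapK.
have did : is_diff (c p) (fun x : 'rV[R]_n => x) id by exact: is_diff_id.
have [_ /(congr1 (@^~ v)) ->] := diff_near_eq ne (@ex_diff _ _ _ _ _ _ _ did).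
exact: (congr1 (@^~ v) (@diff_val _ _ _ _ _ _ _ did)).
Qed.

(** The coordinate extension of a tangent vector, with constant components in
    [c]; it is only meaningful on [chart_dom c]. *)
Definition const_field (c : chart R n M) (w : 'rV[R]_n) : vfield M :=
  fun p => 'd (chart_at p \o chart_inv c) (c p) w.

Lemma tangent_coord_const (c d : chart R n M) p w : atlas c -> atlas d ->
  chart_dom c p -> chart_dom d p ->
  tangent_coord d (const_field c w p) = 'd (d \o chart_inv c) (c p) w.
Proof.
move=> ac ad cp dp.
exact: (local_expr_chain w (smooth_map_id M) (smooth_map_id M) ac
  (chart_at_atlas p) ad cp (chart_at_dom p) dp).
Qed.

Lemma const_field_coord (c : chart R n M) p (v : tangent p) : atlas c ->
  chart_dom c p -> const_field c (tangent_coord c v) p = v.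
Proof.
move=> ac cp; apply: etrans (diff_chart_id v (chart_at_atlas p) (chart_at_dom p)).
exact: (local_expr_chain v (smooth_map_id M) (smooth_map_id M)
  (chart_at_atlas p) ac (chart_at_atlas p) (chart_at_dom p) cp (chart_at_dom p)).
Qed.

Lemma const_field_chart_at p w : const_field (chart_at p) w p = w.
Proof. exact: diff_chart_id (chart_at_atlas p) (chart_at_dom p). Qed.

(** In another chart the components are [w] transformed by the differential of
    the transition map, read at the transition of the point. *)
Lemma const_field_smooth (c : chart R n M) w : atlas c ->
  smooth_vfield (chart_dom c) (const_field c w).
Proof.
move=> ac d ad k.
pose U : set 'rV[R]_n := d @` (chart_dom d `&` chart_dom c).
pose V : set 'rV[R]_n := c @` (chart_dom c `&` chart_dom d).
have oU : open U by apply: chart_image_open; exact: chart_dom_open.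
have oV : open V by apply: chart_image_open; exact: chart_dom_open.
apply: (@Ck_eq _ _ _ _ _
  (fun x => 'd (d \o chart_inv c) (c (chart_inv d x)) w)) => //.
  move=> _ [p [dp cp] <-]; rewrite /vfield_coord !chart_mapK //.
  by rewrite tangent_coord_const.
apply: (@Ck_comp_rV _ _ _ _ _ _ V (fun x => c (chart_inv d x))
  (fun y => 'd (d \o chart_inv c) y w)) => //.
- by move=> _ [p [dp cp] <-]; rewrite chart_mapK //; exists p.
- exact: atlas_compatible ad ac k.
- by have [_] := atlas_compatible ac ad k.+1; apply.
Qed.

Lemma lie_bracket_const (p : M) u v :
  lie_bracket (const_field (chart_at p) u) (const_field (chart_at p) v) p = 0.
Proof.
have ac := chart_at_atlas p; have cp := chart_at_dom p.
have E0 w h : 'd (vfield_coord (chart_at p) (const_field (chart_at p) w))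
    (chart_at p p) h = 0.
  have ne : \forall x \near chart_at p p,
      w = vfield_coord (chart_at p) (const_field (chart_at p) w) x.
    apply: filterS (local_expr_near (smooth_map_id M) cp cp) => _ [q [cq _] <-].
    by rewrite /vfield_coord chart_mapK // tangent_coord_const // diff_chart_id.
  have [_ /(congr1 (@^~ h)) E] := diff_near_eq ne (differentiable_cst w (chart_at p p)).
  by apply: (etrans E); exact: (congr1 (@^~ h) (diff_cst w (chart_at p p))).
exact: (etrans (congr2 (fun s t => s - t) (E0 v _) (E0 u _)) (subrr _)).
Qed.

End OneManifold.

Section Push.
Variables (n m : nat) (N : manifold R n) (M : manifold R m) (i : N -> M).
Hypothesis si : smooth_map i.

Lemma mdiff_const (c : chart R n N) p w : atlas c -> chart_dom c p ->
  mdiff i (const_field c w p) = 'd (chart_at (i p) \o i \o chart_inv c) (c p) w.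
Proof.
move=> ac cp.
exact: (local_expr_chain w (smooth_map_id N) si ac (chart_at_atlas p)
  (chart_at_atlas (i p)) cp (chart_at_dom p) (chart_at_dom (i p))).
Qed.

Lemma const_field_push (c : chart R n N) (d : chart R m M) p w :
  atlas c -> atlas d -> chart_dom c p -> chart_dom d (i p) ->
  const_field d ('d (d \o i \o chart_inv c) (c p) w) (i p) =
  mdiff i (const_field c w p).
Proof.
move=> ac ad cp dp; rewrite mdiff_const //.
exact: (local_expr_chain w si (smooth_map_id M) ac ad (chart_at_atlas (i p))
  cp dp (chart_at_dom (i p))).
Qed.

End Push.

End Charts.

(** * The contact form of a Sasakian manifold *)

Section Sasakian.
Context {R : realType} {m : nat} {M : manifold R m.*2.+1} (S : sasakian M).

Let g_lin := metric_linear (sas_g_metric S).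
Let g_sym := Defs.metric_sym (sas_g_metric S).

Lemma metric0l p (v : tangent p) : sas_g S 0 v = 0.
Proof. by have := g_lin 1 (0 : tangent p) 0 v; rewrite scaler0 addr0 mul1r; lra. Qed.

Lemma metricDl p (u v w : tangent p) :
  sas_g S (u + v) w = sas_g S u w + sas_g S v w.
Proof. by have := g_lin 1 u v w; rewrite scale1r mul1r. Qed.

Lemma metricZl p a (u w : tangent p) : sas_g S (a *: u) w = a * sas_g S u w.
Proof. by have := g_lin a u 0 w; rewrite addr0 metric0l addr0. Qed.

Lemma metricNl p (u w : tangent p) : sas_g S (- u) w = - sas_g S u w.
Proof. by rewrite -scaleN1r metricZl mulN1r. Qed.

Lemma eta_metric p (u : tangent p) : sas_eta S p u = sas_g S u (sas_xi S p).
Proof.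
have := sas_compatible S u (sas_xi S p).
rewrite sas_phi_xi g_sym metric0l sas_eta_xi mulr1; lra.
Qed.

(** Compute [phi (phi (phi u))] in two ways. *)
Lemma eta_phi p (u : tangent p) : sas_eta S p (sas_phi S p u) = 0.
Proof.
have H := sas_phi2 S (sas_phi S p u).
rewrite (sas_phi2 S u) linearD linearN linearZ /= sas_phi_xi scaler0 addr0 in H.
have : sas_eta S p (sas_phi S p u) *: sas_xi S p = 0.
  by apply: (addrI (- sas_phi S p u)); rewrite -H addr0.
by move=> /(congr1 (sas_eta S p)); rewrite linearZ linear0 /= sas_eta_xi mulr1.
Qed.

Lemma phi_skew p (u v : tangent p) :
  sas_g S (sas_phi S p u) v = - sas_g S u (sas_phi S p v).
Proof.
have := sas_compatible S u (sas_phi S p v).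
rewrite eta_phi mulr0 subr0 sas_phi2 g_sym metricDl metricNl metricZl.
rewrite (g_sym (sas_xi S p)) -eta_metric eta_phi mulr0 addr0 (g_sym v).
by move=> <-; rewrite opprK.
Qed.

Let xi_smooth (U : set M) : smooth_vfield U (sas_xi S).
Proof.
move=> c ac k; apply: Ck_sub (sas_xi_smooth S ac k) => _ [p [cp _] <-].
by exists p.
Qed.

Let conn := levi_civita_connection (sas_nabla_levi_civita S).

Let zero_smooth : smooth_vfield setT (fun p : M => 0 : tangent p).
Proof.
move=> c ac k.
have -> : vfield_coord c (fun p : M => 0 : tangent p) = (fun=> 0).
  by apply/funext => x; rewrite /vfield_coord /tangent_coord linear0.
exact: Ck_cst.
Qed.

(** The formula for [nabla phi], applied to the field [xi] that [phi] kills,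
    gives [phi (nabla_v xi) = v - eta v xi].  Applying [phi] again determines
    [nabla_v xi] up to a multiple of [xi], which is zero because [xi] has
    constant length. *)
Lemma nabla_xi p (v : tangent p) : sas_nabla S v (sas_xi S) = - sas_phi S p v.
Proof.
have nabla0 : sas_nabla S v (fun q : M => 0 : tangent q) = 0.
  have := connection_add conn openT zero_smooth zero_smooth (p := p) I v.
  have -> : (fun q : M => 0 + 0 : tangent q) = (fun q => 0).
    by apply: functional_extensionality_dep => q; rewrite addr0.
  move=> H; apply: (addrI (sas_nabla S v (fun q : M => 0 : tangent q))).
  by rewrite -H addr0.
have := sas_nabla_phi S openT (sas_xi_smooth S) (p := p) I v.
have -> : (fun q => sas_phi S q (sas_xi S q)) = (fun q => 0).
  by apply: functional_extensionality_dep => q; exact: sas_phi_xi.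
rewrite nabla0 sub0r sas_eta_xi scale1r -eta_metric => /(congr1 (sas_phi S p)).
rewrite linearN linearB linearZ /= sas_phi_xi scaler0 sub0r sas_phi2.
have eta0 : sas_eta S p (sas_nabla S v (sas_xi S)) = 0.
  have := levi_civita_metric (sas_nabla_levi_civita S) openT
    (sas_xi_smooth S) (sas_xi_smooth S) (p := p) I v.
  rewrite (g_sym (sas_xi S p)) -eta_metric.
  have -> : vderiv v (fun q => sas_g S (sas_xi S q) (sas_xi S q)) = 0.
    have -> : (fun q => sas_g S (sas_xi S q) (sas_xi S q)) = cst 1.
      by apply/funext => q; rewrite -eta_metric sas_eta_xi.
    by rewrite /vderiv; exact: (congr1 (@^~ v) (diff_cst (1 : R^o) _)).
  lra.
by rewrite eta0 scale0r addr0 opprK.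
Qed.

(** The components of [eta] in the chart [c]. *)
Definition eta_form (c : chart R m.*2.+1 M) (w x : 'rV[R]_(m.*2.+1)) : R^o :=
  sas_eta S (chart_inv c x) (const_field c w (chart_inv c x)).

Lemma eta_form_linear c x : linear_at (eta_form c) x.
Proof. by move=> k u w; rewrite /eta_form /const_field linearP [LHS]linearP. Qed.

Lemma eta_form_smooth (c : chart R m.*2.+1 M) w : atlas c ->
  smooth_on (c @` chart_dom c) (eta_form c w).
Proof.
move=> ac k.
have := sas_eta_smooth S (chart_dom_open c) (const_field_smooth w ac) ac k.
by apply: Ck_sub => _ [p cp <-]; exists p.
Qed.

(** With coordinate fields extending [u] and [v], metric compatibility gives
    [v (eta U) = eta (nabla_v U) + g (v, phi u)].  In the difference the first
    terms combine to [eta] of the bracket of the coordinate fields, which is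
    zero, and the others add up by skewness of [phi]. *)
Lemma ext_diff_eta p (u v : tangent p) :
  ext_diff (eta_form (chart_at p)) (chart_at p p) u v =
  2 * sas_g S u (sas_phi S p v).
Proof.
pose X w : vfield M := const_field (chart_at p) w.
have ac := chart_at_atlas p.
have oU := chart_dom_open (chart_at p).
have sX w : smooth_vfield (chart_dom (chart_at p)) (X w) := const_field_smooth w ac.
have Xp w : X w p = w := const_field_chart_at p w.
have LC := sas_nabla_levi_civita S.
have dE (u' v' : tangent p) : 'd (eta_form (chart_at p) v') (chart_at p p) u' =
    sas_eta S p (sas_nabla S u' (X v')) + sas_g S u' (sas_phi S p v').
  have -> : 'd (eta_form (chart_at p) v') (chart_at p p) u' =
      vderiv u' (fun q => sas_eta S q (X v' q)) by [].
  have -> : (fun q => sas_eta S q (X v' q)) =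
      (fun q => sas_g S (X v' q) (sas_xi S q)).
    by apply/funext => q; exact: eta_metric.
  have -> := levi_civita_metric LC oU (sX v') (@xi_smooth _) (chart_at_dom p) u'.
  rewrite -eta_metric nabla_xi Xp (g_sym v') metricNl phi_skew opprK.
  by [].
apply: (etrans (congr2 (fun s t => s - t) (dE u v) (dE v u))).
have := levi_civita_torsion_free LC oU (sX u) (sX v) (chart_at_dom p).
rewrite lie_bracket_const !Xp => /(congr1 (sas_eta S p)).
rewrite linearB linear0 /= (g_sym v) phi_skew.
move: (sas_eta S p _) (sas_eta S p _) (sas_g S u _) => a b c.
lra.
Qed.

End Sasakian.

(** * The contact form along a submanifold *)

Section PulledBack.
Context {R : realType} {m n : nat} {Mbar : manifold R m.*2.+1}.
Variables (S : sasakian Mbar) (M : manifold R n) (i : M -> Mbar).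
Hypothesis si : smooth_map i.

Definition pulled_eta (c : chart R n M) (w x : 'rV[R]_n) : R^o :=
  sas_eta S (i (chart_inv c x)) (mdiff i (const_field c w (chart_inv c x))).

Lemma pulled_etaE (c : chart R n M) w p : chart_dom c p ->
  pulled_eta c w (c p) = sas_eta S (i p) (mdiff i (const_field c w p)).
Proof. by move=> cp; rewrite /pulled_eta chart_mapK. Qed.

Lemma pulled_eta_linear c x : linear_at (pulled_eta c) x.
Proof.
by move=> k u w; rewrite /pulled_eta /const_field /mdiff !linearP.
Qed.

Section TwoCharts.
Variables (c : chart R n M) (d : chart R m.*2.+1 Mbar).
Hypotheses (ac : atlas c) (ad : atlas d).

Let f := d \o i \o chart_inv c.

(** The coordinate expression of [pulled_eta] is the pull-back of [eta_form] by
    the coordinate expression of [i]; its smoothness and its exterior derivative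
    are both read off from this. *)
Lemma pulled_eta_local w p : chart_dom c p -> chart_dom d (i p) ->
  eta_form S d ('d f (c p) w) (f (c p)) = pulled_eta c w (c p).
Proof.
move=> cp dp; rewrite pulled_etaE // /eta_form.
have -> : f (c p) = d (i p) by rewrite /f /= chart_mapK.
by rewrite chart_mapK // const_field_push.
Qed.

Lemma pulled_eta_smooth w k :
  Ck k (c @` (chart_dom c `&` i @^-1` chart_dom d)) (pulled_eta c w).
Proof.
set U := c @` _.
have oU : open U by exact: local_expr_open.
have fk l : Ck l U f := si.2 c d ac ad l.
pose h x : R^o := \sum_j (row_coord j ('d f x w) *
  eta_form S d (delta_mx ord0 j) (f x) : R^o).
apply: (@Ck_eq _ _ _ _ _ h) => //.
  move=> _ [p [cp dp] <-]; rewrite -pulled_eta_local //.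
  by rewrite (linear_at_sum _ (@eta_form_linear _ _ _ S d _)).
apply: Ck_sum => // j; apply: Ck_mul => //.
  by apply: Ck_row_coord => //; have [_] := fk k.+1; apply.
apply: (@Ck_comp _ _ _ _ _ (d @` chart_dom d)) => //.
  by move=> _ [p [cp dp] <-]; exists (i p) => //; rewrite /f /= chart_mapK.
exact: eta_form_smooth.
Qed.

End TwoCharts.

(** The chart of the ambient manifold is taken to be the preferred one at
    [i p], hence changes with [p], because [ext_diff_eta] computes [d eta] only
    at the centre of such a chart. *)
Lemma ext_diff_pulled_eta (c : chart R n M) p u v : atlas c -> chart_dom c p ->
  ext_diff (pulled_eta c) (c p) u v =
  2 * sas_g S (mdiff i (const_field c u p))
        (sas_phi S (i p) (mdiff i (const_field c v p))).
Proof.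
move=> ac cp; pose d := chart_at (i p).
have ad : atlas d := chart_at_atlas (i p).
have dp : chart_dom d (i p) := chart_at_dom (i p).
pose f := d \o i \o chart_inv c.
have fE : f (c p) = d (i p) by rewrite /f /= chart_mapK.
have oU : open (c @` (chart_dom c `&` i @^-1` chart_dom d)).
  exact: local_expr_open.
have Up : (c @` (chart_dom c `&` i @^-1` chart_dom d)) (c p) by exists p.
have -> : ext_diff (pulled_eta c) (c p) u v =
    ext_diff (eta_form S d) (f (c p)) ('d f (c p) u) ('d f (c p) v).
  apply: (ext_diff_pullback oU (si.2 c d ac ad 2) Up).
  - apply: filterS (@filterT _ (nbhs (f (c p))) _) => y _.
    exact: eta_form_linear.
  - move=> w; rewrite -/f fE.
    by have [H _] := eta_form_smooth S w ad 1; apply: H; exists (i p).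
  - move=> w; apply: filterS (local_expr_near si cp dp) => _ [q [cq dq] <-].
    exact: pulled_eta_local.
rewrite fE ext_diff_eta.
by rewrite !mdiff_const.
Qed.

(** The tangential part is a chosen value, so one has to see that a normal
    vector admits only [0]: a tangential part of it would be normal and tangent,
    hence of zero length. *)
Lemma P_op_eq0 p (u : tangent p) : injective (@mdiff R n _ M Mbar i p) ->
  normal_vector S (sas_phi S (i p) (mdiff i u)) -> P_op S i u = 0.
Proof.
move=> inj Nu; rewrite /P_op /tangential_part.
set V := sas_phi _ _ _ in Nu *.
case: xgetP => [w _ Nw|//].
have Nw0 : normal_vector S (mdiff i w).
  move=> z; have := Nw z; rewrite metricDl Nu metricNl add0r => /eqP.
  by rewrite oppr_eq0 => /eqP.
have w0 : mdiff i w = 0.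
  apply/eqP/negPn/negP => /(metric_pos (sas_g_metric S)).
  by rewrite Nw0 ltxx.
by apply: inj; rewrite w0 /mdiff linear0.
Qed.

End PulledBack.

Theorem proposition3p3 (R : realType) (m n : nat)
    (Mbar : manifold R m.*2.+1) (S : sasakian Mbar)
    (M : manifold R n) (i : M -> Mbar) (D : smooth_distribution M)
    (hPTR : PTR_submanifold S i D)
    (hmax : maximal_totally_real S i D) :
  integrable_distribution D.
Proof.
have [[si inj] _ _ eta0 real0] := hPTR.
move=> U0 X Y oU0 sX sY XD YD p Up.
pose c := chart_at p; pose d := chart_at (i p).
have ac : atlas c := chart_at_atlas p.
have ad : atlas d := chart_at_atlas (i p).
have cp : chart_dom c p := chart_at_dom p.
have dp : chart_dom d (i p) := chart_at_dom (i p).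
(* inside the domain of one ambient chart, where pulled_eta_smooth applies *)
pose W := U0 `&` i @^-1` chart_dom d.
have oW : open W.
  by apply: openI => //; apply: open_comp (chart_dom_open d) => q _; exact: si.1.
pose U := c @` (chart_dom c `&` W).
have oU : open U by exact: chart_image_open.
have a2 w : Ck 2 U (pulled_eta S i c w).
  apply: Ck_sub (pulled_eta_smooth S si ac ad w 2).
  by move=> _ [q [cq [_ dq]] <-]; exists q.
have dfield Z : smooth_vfield U0 Z ->
    forall x, U x -> differentiable (vfield_coord c Z) x.
  move=> sZ _ [q [cq [Uq _]] <-]; have [H _] := sZ c ac 1.
  by apply: H; exists q.
have charZ Z : (forall q, U0 q -> Z q \in D q) -> forall x, U x ->
    pulled_eta S i c (vfield_coord c Z x) x = 0 /\
    forall v, ext_diff (pulled_eta S i c) x (vfield_coord c Z x) v = 0.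
  move=> ZD _ [q [cq [Uq _]] <-].
  have Zq : const_field c (vfield_coord c Z (c q)) q = Z q.
    by rewrite /vfield_coord chart_mapK // const_field_coord.
  split=> [|v]; first by rewrite pulled_etaE // Zq; exact/eta0/ZD.
  rewrite ext_diff_pulled_eta // Zq -[X in 2 * X]opprK -phi_skew.
  by rewrite (real0 _ _ (ZD _ Uq)) oppr0 mulr0.
have Ucp : U (c p) by exists p.
have [] := characteristic_involutive oU
  (fun x _ => @pulled_eta_linear _ _ _ _ S M i c x)
  a2 (dfield X sX) (dfield Y sY) (charZ X XD) (charZ Y YD) Ucp.
rewrite -/(lie_bracket X Y p) => aZ dZ.
apply/hmax; split.
  by move: aZ; rewrite pulled_etaE // const_field_chart_at.
apply: P_op_eq0; first exact: inj.
move=> v; have := dZ v.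
rewrite ext_diff_pulled_eta // !const_field_chart_at phi_skew => /eqP.
by rewrite mulf_eq0 pnatr_eq0 /= => /eqP ->; rewrite oppr0.
Qed.
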